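(* The following two assertions are equivalent. (I) For every non-empty finite set $C$ and every $P\subseteq C^+$ such that $P$ and $C^+\setminus P$ are closed under concatenations and cyclic shifts, there exist a totally ordered group $(G,+,\le)$ and a valuation of colors $\mathrm{val}\colon C\to G$ such that $P=\{x\in C^+\mid\mathrm{val}(x)<0\}$. (II) For every non-empty finite set $C$ and every $P\subseteq C^+$ such that $P$ and $C^+\setminus P$ are closed under concatenations and cyclic shifts, there exists an invariant sub-semigroup $S$ of the free group $F_C$ such that, first, $C^+\setminus P$ is a subset of $S$; second, $P$ is disjoint from $S$; and third, for every $g\in F_C$ either $g\in S$ or $g^{-1}\in S$ (in particular, $S$ contains the neutral element).
   Context: $C^*$ and $C^+$ denote the sets of finite and finite non-empty words over $C$. $F_C$ is the free group over $C$; words in $C^+$ are regarded as elements of $F_C$ in the natural way. A set $Q\subseteq C^+$ is closed under concatenations if $x,y\in Q$ implies $xy\in Q$, and closed under cyclic shifts if $c_1c_2\ldots c_n\in Q$ (with $c_i\in C$) implies $c_2\ldots c_nc_1\in Q$. A totally ordered group is a triple $(G,+,\le)$ where $(G,+)$ is a (not necessarily abelian) group and $\le$ is a total order on $G$ such that $a\le b$ implies $x+a+y\le x+b+y$ for all $a,b,x,y\in G$. A valuation of colors is a function $\mathrm{val}\colon C\to G$, extended to $C^*$ by $\mathrm{val}(\text{empty word})=0$, $\mathrm{val}(c_1\ldots c_n)=\mathrm{val}(c_1)+\ldots+\mathrm{val}(c_n)$. A subset $S$ of a group $G$ (written multiplicatively) is an invariant sub-semigroup of $G$ if $xy\in S$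 for all $x,y\in S$, and $gxg^{-1}\in S$ for all $g\in G$, $x\in S$. In (II), ''either ... or'' is inclusive (both $g$ and $g^{-1}$ may lie in $S$). *)

(* Defs.v *)
From HB Require Import structures.
From mathcomp Require Import all_boot all_order.
From mathcomp Require Import classical_sets.

Set Implicit Arguments.
Unset Strict Implicit.
Unset Printing Implicit Defensive.

Local Open Scope group_scope.
Local Open Scope classical_set_scope.

Definition nonempty_words (C : Type) : set (seq C) := [set w | w <> [::]].
Arguments nonempty_words : clear implicits.

Definition concat_closed (C : Type) (Q : set (seq C)) :=
  forall x y, Q x -> Q y -> Q (x ++ y).

Definition cyclic_shift_closed (C : Type) (Q : set (seq C)) :=
  forall c w, Q (c :: w) -> Q (rcons w c).

Definition invariant_subsemigroup (G : groupType) (S : set G) :=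
  (forall x y, S x -> S y -> S (x * y)) /\
  (forall g x, S x -> S (g * x * g^-1)).

Definition word_val (C : Type) (G : groupType) (v : C -> G) (w : seq C) : G :=
  \prod_(c <- w) v c.

(* The library's additive groups are abelian, so an ordered group, which need
   not be, is written multiplicatively: [*], [1] stand for [+], [0]. *)
HB.mixin Record isOrderedGroup d G of Group G & Order.Total d G := {
  le_mulg2 : forall a b x y : G,
    (a <= b)%O -> (x * a * y <= x * b * y)%O
}.

#[short(type="orderedGroupType")]
HB.structure Definition OrderedGroup d :=
  {G of isOrderedGroup d G & Group G & Order.Total d G}.

(* The free group over C is the set of reduced words over the letters (c, false),
   standing for c, and (c, true), standing for c^-1. *)
Section FreeGroup.
Variable C : choiceType.

Definition letter_inv (a : C * bool) : C * bool := (a.1, ~~ a.2).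

Definition reduced (w : seq (C * bool)) :=
  sorted (fun a b => b != letter_inv a) w.

Record free_group := FreeGroup {
  free_word :> seq (C * bool);
  free_word_reduced : reduced free_word }.

HB.instance Definition _ := [isSub for free_word].
HB.instance Definition _ := [Choice of free_group by <:].

Definition reduced_cons (a : C * bool) (w : seq (C * bool)) :=
  if w is b :: w' then if b == letter_inv a then w' else a :: w else [:: a].

Definition reduced_cat (u v : seq (C * bool)) := foldr reduced_cons v u.

Lemma letter_invK : involutive letter_inv.
Proof. by case=> c b; rewrite /letter_inv /= negbK. Qed.

Lemma reduced_consP a w : reduced w -> reduced (reduced_cons a w).
Proof.
case: w => [//|b w] /=; case: ifP => [_ /path_sorted //|] ba rw.
by rewrite /= ba.
Qed.

Lemma reduced_catP u v : reduced v -> reduced (reduced_cat u v).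
Proof. by move=> rv; elim: u => //= a u; apply: reduced_consP. Qed.

Lemma reduced_behead a w : reduced (a :: w) -> reduced w.
Proof. exact: path_sorted. Qed.

Lemma reduced_consE a w : reduced (a :: w) -> reduced_cons a w = a :: w.
Proof. by case: w => //= b w /andP[/negPf ->]. Qed.

Lemma reduced_consK a w :
  reduced w -> reduced_cons (letter_inv a) (reduced_cons a w) = w.
Proof.
case: w => [_|b w rw]; first by rewrite /= letter_invK eqxx.
rewrite /=; case: (b =P letter_inv a) => [ba|_]; last first.
  by rewrite /= letter_invK eqxx.
by rewrite -ba reduced_consE.
Qed.

Lemma reduced_cat_cons a v w : reduced v -> reduced w ->
  reduced_cat (reduced_cons a v) w = reduced_cons a (reduced_cat v w).
Proof.
case: v => [//|b v] rv rw /=; case: eqP => [->|//].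
rewrite -{1}[a]letter_invK reduced_consK //.
exact: reduced_catP.
Qed.

Lemma reduced_catA u v w : reduced v -> reduced w ->
  reduced_cat u (reduced_cat v w) = reduced_cat (reduced_cat u v) w.
Proof.
move=> rv rw; elim: u => //= a u ->.
by rewrite reduced_cat_cons //; apply: reduced_catP.
Qed.

Lemma reduced_cats0 u : reduced u -> reduced_cat u [::] = u.
Proof.
elim: u => //= a u IHu rau.
by rewrite IHu ?reduced_consE //; apply: reduced_behead rau.
Qed.

Lemma reduced_rev_inv u : reduced u -> reduced (rev (map letter_inv u)).
Proof.
rewrite /reduced rev_sorted sorted_map; apply: sub_sorted => a b /=.
by rewrite letter_invK eq_sym.
Qed.

Lemma reduced_catV u : reduced_cat (rev (map letter_inv u)) u = [::].
Proof.
elim: u => //= a u IHu.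
by rewrite rev_cons -cats1 /reduced_cat foldr_cat /= letter_invK eqxx.
Qed.

Lemma reduced_catV' u : reduced_cat u (rev (map letter_inv u)) = [::].
Proof.
rewrite -{1}[u]revK -[u in rev (rev u)](mapK letter_invK) -map_rev.
exact: reduced_catV.
Qed.

Definition free_one : free_group := @FreeGroup [::] isT.

Definition free_mul (u v : free_group) : free_group :=
  FreeGroup (reduced_catP u (free_word_reduced v)).

Definition free_inv (u : free_group) : free_group :=
  FreeGroup (reduced_rev_inv (free_word_reduced u)).

Lemma free_mulA : associative free_mul.
Proof.
by move=> u v w; apply: val_inj; apply: reduced_catA; apply: free_word_reduced.
Qed.

Lemma free_mul1 : left_id free_one free_mul.
Proof. by move=> u; apply: val_inj. Qed.

Lemma free_mulr1 : right_id free_one free_mul.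
Proof.
by move=> u; apply: val_inj; apply: reduced_cats0; apply: free_word_reduced.
Qed.

Lemma free_mulV : left_inverse free_one free_inv free_mul.
Proof. by move=> u; apply: val_inj; apply: reduced_catV. Qed.

Lemma free_mulrV : right_inverse free_one free_inv free_mul.
Proof. by move=> u; apply: val_inj; apply: reduced_catV'. Qed.

HB.instance Definition _ :=
  isGroup.Build free_group free_mulA free_mul1 free_mulr1 free_mulV free_mulrV.

Definition free_gen (c : C) : free_group := @FreeGroup [:: (c, false)] isT.

End FreeGroup.

Definition word_free (C : choiceType) (w : seq C) : free_group C :=
  word_val (@free_gen C) w.

Lemma free_word_word_free (C : choiceType) (w : seq C) :
  word_free w = [seq (c, false) | c <- w] :> seq (C * bool).
Proof.
rewrite /word_free /word_val; elim: w => [|c w IHw]; first by rewrite big_nil.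
by rewrite big_cons /= {1}IHw; case: w {IHw} => //= d w; rewrite xpair_eqE andbF.
Qed.

(* Main.v *)
From HB Require Import structures.
Require Import Defs.
From mathcomp Require Import all_boot all_order.
From mathcomp Require Import classical_sets boolp.

Set Implicit Arguments.
Unset Strict Implicit.
Unset Printing Implicit Defensive.

Import Order.TTheory.

(** Both assertions quantify over the same [C] and [P], and they are equivalent
    already for each fixed [P].

    In an ordered group [G] the set of elements [>= 1] is an invariant
    sub-semigroup which meets every pair [{g, g^-1}].  A valuation [C -> G]
    extends to a morphism [F_C -> G] ([free_ext]), and the preimage of that set
    inherits these properties ([invariant_subsemigroup_ge1]).  Since a non-empty
    word lies in [P] exactly when its value is [< 1], this preimage contains the
    words outside [P] and none of those in [P].

    Conversely, let [S] be an invariant sub-semigroup of a group, meeting every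
    pair [{g, g^-1}].  Then [x <= y] iff [S (x^-1 * y)] defines a total preorder,
    compatible with multiplication on both sides because [S] is invariant.  It
    need not be antisymmetric, since [S] may contain both [g] and [g^-1]; but the
    elements equivalent to [1] form the normal subgroup of all [g] with
    [g, g^-1] in [S], and the quotient by it is an ordered group
    ([cone_quotient]) in which the class of [g] is [>= 1] exactly when [S g]
    ([cone_proj_ge1]).  Applied to [F_C], with each color valued as the class of
    its generator, a word is negative exactly when it lies outside [S], that is,
    in [P]. *)

Local Open Scope group_scope.
Local Open Scope classical_set_scope.
Local Open Scope quotient_scope.

(** * Extending a valuation to the free group *)

Section FreeExtension.
Variables (C : choiceType) (G : groupType) (v : C -> G).

Definition letter_val (a : C * bool) : G := if a.2 then (v a.1)^-1 else v a.1.

Definition free_ext (g : free_group C) : G :=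
  \prod_(a <- free_word g) letter_val a.

Lemma letter_val_inv a : letter_val (letter_inv a) = (letter_val a)^-1.
Proof. by case: a => c [] //=; rewrite /letter_val /= invgK. Qed.

(** Reduction only deletes adjacent mutually inverse letters, whose values
    cancel in [G]. *)
Lemma prod_reduced_cons a w :
  \prod_(b <- reduced_cons a w) letter_val b =
  letter_val a * \prod_(b <- w) letter_val b.
Proof.
case: w => [|b w] /=; first by rewrite big_cons.
case: eqP => [->|_]; last by rewrite big_cons.
by rewrite big_cons letter_val_inv mulVKg.
Qed.

Lemma free_extM : {morph free_ext : g h / g * h}.
Proof.
move=> [u ru] h; rewrite /free_ext /= {ru}.
elim: u => [|a u IHu] /=; first by rewrite big_nil mul1g.
by rewrite prod_reduced_cons IHu big_cons mulgA.
Qed.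

HB.instance Definition _ := isMultiplicative.Build _ _ free_ext free_extM.

Lemma free_ext1 : free_ext 1 = 1.
Proof. by rewrite /free_ext big_nil. Qed.

HB.instance Definition _ :=
  Multiplicative_isUMagmaMorphism.Build _ _ free_ext free_ext1.

Lemma free_ext_word w : free_ext (word_free w) = word_val v w.
Proof. by rewrite /free_ext free_word_word_free big_map. Qed.

End FreeExtension.

(** * Elements above 1 in an ordered group *)

Lemma mul_ge1 d (G : orderedGroupType d) (x y : G) :
  (1 <= x)%O -> (1 <= y)%O -> (1 <= x * y)%O.
Proof.
move=> x1 y1; apply: le_trans x1 _.
by have := le_mulg2 _ _ x 1 y1; rewrite !mulg1.
Qed.

Lemma conj_ge1 d (G : orderedGroupType d) (g x : G) :
  (1 <= x)%O -> (1 <= g * x * g^-1)%O.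
Proof. by move=> /(le_mulg2 _ _ g g^-1); rewrite mulg1 mulgV. Qed.

Lemma ge1_or_inv d (G : orderedGroupType d) (x : G) :
  (1 <= x)%O \/ (1 <= x^-1)%O.
Proof.
have [x1|/ltW x1] := leP 1 x; [by left | right].
by have := le_mulg2 _ _ x^-1 1 x1; rewrite !mulg1 mulVg.
Qed.

Lemma invariant_subsemigroup_ge1 d (H : groupType) (G : orderedGroupType d)
    (f : UMagmaMorphism.type H G) :
  invariant_subsemigroup [set g | (1 <= f g)%O].
Proof.
split=> [x y|g x] /=; first by rewrite gmulfM; apply: mul_ge1.
by rewrite !gmulfM gmulfV; apply: conj_ge1.
Qed.

(** * The ordered quotient by an invariant sub-semigroup *)

Section ConeQuotient.
Variables (G : groupType) (S : set G).
Hypothesis S_inv : invariant_subsemigroup S.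
Hypothesis S_total : forall g, S g \/ S g^-1.

(** The preorder for which [S] is the set of elements above [1]. *)
Definition cone_le : rel G := fun x y => `[< S (x^-1 * y) >].

Lemma cone_1 : S 1.
Proof. by case: (S_total 1) => //; rewrite invg1. Qed.

Lemma cone_le_refl : reflexive cone_le.
Proof. by move=> x; apply/asboolP; rewrite mulVg; apply: cone_1. Qed.

Lemma cone_le_trans : transitive cone_le.
Proof.
move=> y x z /asboolP xy /asboolP yz; apply/asboolP.
by have := S_inv.1 _ _ xy yz; rewrite -mulgA mulVKg.
Qed.

Lemma cone_le_total : total cone_le.
Proof.
move=> x y; case: (S_total (x^-1 * y)) => Sxy; apply/orP; [left | right].
  exact/asboolP.
by apply/asboolP; move: Sxy; rewrite invgM invgK.
Qed.

(** The left factor cancels in [(x * a * y)^-1 * (x * b * y)], which leaves the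
    conjugate of [a^-1 * b] by [y^-1]: this is where invariance is needed. *)
Lemma cone_le_mul2 x y a b : cone_le a b -> cone_le (x * a * y) (x * b * y).
Proof.
move=> /asboolP ab; apply/asboolP.
by have := S_inv.2 y^-1 _ ab; rewrite invgK !invgM -!mulgA mulKg.
Qed.

Lemma cone_leM a b c d :
  cone_le a b -> cone_le c d -> cone_le (a * c) (b * d).
Proof.
move=> /(cone_le_mul2 1 c) ab /(cone_le_mul2 b 1) cd.
by move: ab cd; rewrite !mul1g !mulg1; apply: cone_le_trans.
Qed.

Lemma cone_leV a b : cone_le a b -> cone_le b^-1 a^-1.
Proof. by move=> /(cone_le_mul2 a^-1 b^-1); rewrite mulVg mul1g mulgK. Qed.

Definition cone_eq : rel G := fun x y => cone_le x y && cone_le y x.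

Lemma cone_eq_refl : reflexive cone_eq.
Proof. by move=> x; rewrite /cone_eq cone_le_refl. Qed.

Lemma cone_eq_sym : symmetric cone_eq.
Proof. by move=> x y; rewrite /cone_eq andbC. Qed.

Lemma cone_eq_trans : transitive cone_eq.
Proof.
move=> y x z /andP[xy yx] /andP[yz zy].
by rewrite /cone_eq (cone_le_trans xy yz) (cone_le_trans zy yx).
Qed.

Definition cone_equiv := EquivRel cone_eq cone_eq_refl cone_eq_sym cone_eq_trans.

Definition cone_quotient := {eq_quot cone_equiv}.

HB.instance Definition _ := Choice.on cone_quotient.
HB.instance Definition _ := EqQuotient.on cone_quotient.

Definition cone_proj (x : G) : cone_quotient := \pi x.

Lemma cone_projP x y : reflect (cone_proj x = cone_proj y) (cone_eq x y).
Proof. exact: (eqmodP cone_equiv). Qed.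

Lemma cone_projK (u : cone_quotient) : cone_proj (repr u) = u.
Proof. exact: reprK. Qed.

Lemma repr_cone_proj x : cone_eq (repr (cone_proj x)) x.
Proof. by apply/cone_projP; rewrite cone_projK. Qed.

Lemma cone_projW (T : cone_quotient -> Prop) :
  (forall x, T (cone_proj x)) -> forall u, T u.
Proof. by move=> Tproj u; rewrite -[u]cone_projK. Qed.

Definition cone_mul (u v : cone_quotient) := cone_proj (repr u * repr v).
Definition cone_inv (u : cone_quotient) := cone_proj (repr u)^-1.
Definition cone_qle : rel cone_quotient := fun u v => cone_le (repr u) (repr v).

Lemma cone_mulE x y : cone_mul (cone_proj x) (cone_proj y) = cone_proj (x * y).
Proof.
apply/cone_projP; have /andP[x1 x2] := repr_cone_proj x.
by have /andP[y1 y2] := repr_cone_proj y; rewrite /cone_eq !cone_leM.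
Qed.

Lemma cone_invE x : cone_inv (cone_proj x) = cone_proj x^-1.
Proof.
apply/cone_projP; have /andP[x1 x2] := repr_cone_proj x.
by rewrite /cone_eq !cone_leV.
Qed.

Lemma cone_qleE x y : cone_qle (cone_proj x) (cone_proj y) = cone_le x y.
Proof.
have /andP[x1 x2] := repr_cone_proj x; have /andP[y1 y2] := repr_cone_proj y.
apply/idP/idP => xy.
  exact: cone_le_trans x2 (cone_le_trans xy y1).
exact: cone_le_trans x1 (cone_le_trans xy y2).
Qed.

Lemma cone_mulA : associative cone_mul.
Proof.
elim/cone_projW=> x; elim/cone_projW=> y; elim/cone_projW=> z.
by rewrite !cone_mulE mulgA.
Qed.

Lemma cone_mul1g : left_id (cone_proj 1) cone_mul.
Proof. by elim/cone_projW=> x; rewrite cone_mulE mul1g. Qed.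

Lemma cone_mulg1 : right_id (cone_proj 1) cone_mul.
Proof. by elim/cone_projW=> x; rewrite cone_mulE mulg1. Qed.

Lemma cone_mulVg : left_inverse (cone_proj 1) cone_inv cone_mul.
Proof. by elim/cone_projW=> x; rewrite cone_invE cone_mulE mulVg. Qed.

Lemma cone_mulgV : right_inverse (cone_proj 1) cone_inv cone_mul.
Proof. by elim/cone_projW=> x; rewrite cone_invE cone_mulE mulgV. Qed.

HB.instance Definition _ := isGroup.Build cone_quotient
  cone_mulA cone_mul1g cone_mulg1 cone_mulVg cone_mulgV.

Lemma cone_qle_refl : reflexive cone_qle.
Proof. by move=> u; apply: cone_le_refl. Qed.

Lemma cone_qle_anti : antisymmetric cone_qle.
Proof.
elim/cone_projW=> x; elim/cone_projW=> y.
by rewrite !cone_qleE => xy; apply/cone_projP.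
Qed.

Lemma cone_qle_trans : transitive cone_qle.
Proof. by move=> v u w; apply: cone_le_trans. Qed.

Lemma cone_qle_total : total cone_qle.
Proof. by move=> u v; apply: cone_le_total. Qed.

HB.instance Definition _ := Order.Le_isPOrder.Build (Order.Disp tt tt)
  cone_quotient cone_qle_refl cone_qle_anti cone_qle_trans.

HB.instance Definition _ := Order.POrder_isTotal.Build (Order.Disp tt tt)
  cone_quotient cone_qle_total.

Lemma cone_qle_mul2 (a b x y : cone_quotient) :
  (a <= b)%O -> (x * a * y <= x * b * y)%O.
Proof.
elim/cone_projW: a => a; elim/cone_projW: b => b.
elim/cone_projW: x => x; elim/cone_projW: y => y.
have mulE s t : cone_proj s * cone_proj t = cone_proj (s * t) := cone_mulE s t.
rewrite !mulE => ab; have {}ab : cone_le a b by rewrite -cone_qleE.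
by rewrite /Order.le /= cone_qleE cone_le_mul2.
Qed.

HB.instance Definition _ :=
  isOrderedGroup.Build (Order.Disp tt tt) cone_quotient cone_qle_mul2.

Lemma cone_proj_ge1 x : (1 <= cone_proj x)%O <-> S x.
Proof.
rewrite [(_ <= _)%O]cone_qleE /cone_le invg1 mul1g.
by split=> [/asboolP|/asboolP].
Qed.

Lemma word_val_cone_proj (C : Type) (v : C -> G) w :
  word_val (cone_proj \o v) w = cone_proj (word_val v w).
Proof.
apply/esym; apply: (big_morph cone_proj) => // x y.
by rewrite -cone_mulE.
Qed.

End ConeQuotient.

(** * Words with a negative value *)

Theorem proposition6 :
  (forall (C : finType) (P : set (seq C)),
     (0 < #|C|)%N ->
     P `<=` nonempty_words C ->
     concat_closed P ->
     cyclic_shift_closed P ->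
     concat_closed (nonempty_words C `\` P) ->
     cyclic_shift_closed (nonempty_words C `\` P) ->
     exists (d : Order.disp_t) (G : orderedGroupType d) (v : C -> G),
       P = [set x | nonempty_words C x /\ (word_val v x < 1)%O])
  <->
  (forall (C : finType) (P : set (seq C)),
     (0 < #|C|)%N ->
     P `<=` nonempty_words C ->
     concat_closed P ->
     cyclic_shift_closed P ->
     concat_closed (nonempty_words C `\` P) ->
     cyclic_shift_closed (nonempty_words C `\` P) ->
     exists S : set (free_group C),
       [/\ invariant_subsemigroup S,
           [set word_free x | x in nonempty_words C `\` P] `<=` S,
           [set word_free x | x in P] `&` S = set0
         & forall g : free_group C, S g \/ S g^-1]).
Proof.
split=> H C P C0 PC P1 P2 P3 P4.
- have [d [G [v PE]]] := H C P C0 PC P1 P2 P3 P4.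
  exists [set g | (1 <= free_ext v g)%O]; split.
  + exact: (invariant_subsemigroup_ge1 (free_ext v)).
  + move=> _ [x [x0 Px] <-] /=; rewrite free_ext_word leNgt.
    by apply/negP => x1; apply: Px; rewrite PE.
  + rewrite -subset0 => _ [[x + <-]] /=.
    by rewrite PE free_ext_word => -[_ x1]; rewrite leNgt x1.
  + by move=> g /=; rewrite gmulfV; apply: ge1_or_inv.
- have [S [S_inv SP PS S_total]] := H C P C0 PC P1 P2 P3 P4.
  exists (Order.Disp tt tt), (cone_quotient S_inv S_total).
  exists (cone_proj S_inv S_total \o @free_gen C).
  apply/seteqP; split=> x /=; rewrite word_val_cone_proj -/(word_free x) ltNge.
    move=> Px; split; first exact: PC.
    apply/negP => /cone_proj_ge1 Sx.
    have : ([set word_free x | x in P] `&` S) (word_free x).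
      by split=> //; exists x.
    by rewrite PS.
  move=> [x0 /negP xS]; apply: contrapT => Px; apply: xS.
  by apply/cone_proj_ge1/SP; exists x.
Qed.
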